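(* Assume that for $\alpha=1,2$ there is a constant $M_\alpha>0$ such that $$f_\alpha(x,y,t,\mathbf 0)\le0,\qquad f_\alpha(x,y,t,u)\ge-M_\alpha\ \text{ for all } u=(u_1,u_2)\ge\mathbf 0,\qquad (x,y,t)\in\overline Q_T,$$ $g_\alpha\ge0$ on $\partial Q_T$ and $\psi_\alpha\ge0$ on $\overline\omega$. Let $$\widehat U_\alpha(p,t_m)=\begin{cases}\psi_\alpha(p),&m=0,\\0,&m\ge1,\end{cases}\qquad p\in\overline\Omega^h,\ \alpha=1,2,$$ and let $\widetilde U_\alpha$, $\alpha=1,2$, be the solutions of the linear problems $$(\mathcal L^h_\alpha(p,t_m)+\tau^{-1})\widetilde U_\alpha(p,t_m)=\tau^{-1}\widetilde U_\alpha(p,t_{m-1})+M_\alpha,\quad p\in\Omega^h,\ m\ge1,$$ $$\widetilde U_\alpha(p,t_m)=g_\alpha(p,t_m),\ p\in\partial\Omega^h,\ m\ge1,\qquad \widetilde U_\alpha(p,0)=\psi_\alpha(p),\ p\in\overline\Omega^h.$$ Then $\widehat U$ and $\widetilde U$ are ordered lower and upper solutions (nondecreasing case) of the scheme (NDS), and $$0\le\widehat U_\alpha(p,t_m)\le\widetilde U_\alpha(p,t_m),\qquad p\in\overline\Omega^h,\ \alpha=1,2,\ m\ge1.$$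
   Context: Data: $l_1,l_2,T>0$, $\omega=(0,l_1)\times(0,l_2)$, $Q_T=\omega\times(0,T]$, $\partial Q_T=\partial\omega\times(0,T]$; for $\alpha=1,2$: constants $\varepsilon_\alpha>0$, smooth functions $f_\alpha(x,y,t,u)$, $u=(u_1,u_2)$, $g_\alpha$ on $\partial Q_T$, $\psi_\alpha$ on $\overline\omega$, and smooth nonnegative $v_{\alpha,1},v_{\alpha,2}$ on $\overline Q_T$. Vector inequalities are componentwise. Mesh: $x_i=ih_x$ ($0\le i\le N_x$, $h_x=l_1/N_x$), $y_j=jh_y$ ($0\le j\le N_y$, $h_y=l_2/N_y$), $t_m=m\tau$ ($0\le m\le N_\tau$, $\tau=T/N_\tau$). $\overline\Omega^h$ is the set of all $p=(x_i,y_j)$, $\Omega^h$ the interior ones, $\partial\Omega^h=\overline\Omega^h\setminus\Omega^h$. ''$m\ge1$'' means $1\le m\le N_\tau$. Operator: $\mathcal L^h_\alpha U_\alpha=-\varepsilon_\alpha(D_x^2U_\alpha+D_y^2U_\alpha)+v_{\alpha,1}D_x^1U_\alpha+v_{\alpha,2}D_y^1U_\alpha$, with $D_x^2,D_y^2$ the standard second central differences and $D_x^1,D_y^1$ the backward differences. Scheme (NDS): for $\alpha=1,2$, $m\ge1$, $(\mathcal L^h_\alpha(p,t_m)+\tau^{-1})U_\alpha(p,t_m)+f_\alpha(p,t_m,U)-\tau^{-1}U_\alpha(p,t_{m-1})=0$ for $p\in\Omega^h$; $U(p,t_m)=g(p,t_m)$ for $p\in\partial\Omega^h$; $U(p,0)=\psi(p)$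 for $p\in\overline\Omega^h$. Ordered upper and lower solutions (nondecreasing case): $\widetilde U,\widehat U$ are such if, for all $m\ge1$ and $\alpha=1,2$: $\widetilde U\ge\widehat U$ on $\overline\Omega^h$; on $\Omega^h$, $(\mathcal L^h_\alpha+\tau^{-1})\widetilde U_\alpha(p,t_m)+f_\alpha(p,t_m,\widetilde U)-\tau^{-1}\widetilde U_\alpha(p,t_{m-1})\ge0$ and $(\mathcal L^h_\alpha+\tau^{-1})\widehat U_\alpha(p,t_m)+f_\alpha(p,t_m,\widehat U)-\tau^{-1}\widehat U_\alpha(p,t_{m-1})\le0$; $\widehat U\le g\le\widetilde U$ on $\partial\Omega^h$; and $\widehat U(p,0)\le\psi(p)\le\widetilde U(p,0)$ on $\overline\Omega^h$. *)

(* Defs.v *)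
From HB Require Import structures.
From mathcomp Require Export all_boot all_order all_algebra.
From mathcomp Require Export all_classical all_reals all_analysis.
Export Order.TTheory GRing.Theory Num.Theory numFieldNormedType.Exports.
Set Implicit Arguments.
Unset Strict Implicit.
Unset Printing Implicit Defensive.

Local Open Scope classical_set_scope.
Local Open Scope ring_scope.

(* C^k on an open set W, for V finite-dimensional (here a product of copies of
   R): all directional derivatives of order <= k exist and are continuous. *)
Fixpoint Ck (R : realType) (V : normedModType R) (k : nat) (W : set V)
    (F : V -> R) : Prop :=
  (forall x, W x -> {for x, continuous F}) /\
  match k with
  | 0%N => True
  | k'.+1 => forall v : V,
      (forall x, W x -> derivable F x v) /\ Ck k' W ('D_v F)
  end.

(* Smoothness on an arbitrary (not necessarily open) subset A: near each of its
   points F agrees on A with a C^oo function defined on an open set.  Values of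
   F outside A are irrelevant. *)
Definition smooth_on (R : realType) (V : normedModType R) (A : set V)
    (F : V -> R) : Prop :=
  forall x, A x -> exists (W : set V) (G : V -> R),
    [/\ open W, W x, forall k, Ck k W G
      & forall y, W y -> A y -> G y = F y].

Definition boundary (X : topologicalType) (A : set X) : set X :=
  closure A `\` interior A.

Definition omega (R : realType) (l1 l2 : R) : set (R * R) :=
  `]0, l1[ `*` `]0, l2[.

Definition QT (R : realType) (l1 l2 T : R) : set (R * R * R) :=
  omega l1 l2 `*` `]0, T].

(* The lateral boundary: the bottom t = 0 and the top t = T are not included
   as faces. *)
Definition dQT (R : realType) (l1 l2 T : R) : set (R * R * R) :=
  boundary (omega l1 l2) `*` `]0, T].

(* The index alpha = 1, 2 ranges over 'I_2; a triple (x, y, t) is an element of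
   R * R * R, and u = (u_1, u_2) is a row vector.  The data are total functions,
   constrained only on their domains of definition. *)
Record problem (R : realType) := Problem {
  len1 : R;
  len2 : R;
  Tmax : R;
  eps : 'I_2 -> R;
  v1 : 'I_2 -> R * R * R -> R;
  v2 : 'I_2 -> R * R * R -> R;
  f : 'I_2 -> R * R * R -> 'rV[R]_2 -> R;
  g : 'I_2 -> R * R * R -> R;
  psi : 'I_2 -> R * R -> R;
  len1_gt0 : 0 < len1;
  len2_gt0 : 0 < len2;
  Tmax_gt0 : 0 < Tmax;
  eps_gt0 : forall a, 0 < eps a;
  v1_smooth : forall a, smooth_on (closure (QT len1 len2 Tmax)) (v1 a);
  v2_smooth : forall a, smooth_on (closure (QT len1 len2 Tmax)) (v2 a);
  v1_ge0 : forall a q, closure (QT len1 len2 Tmax) q -> 0 <= v1 a q;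
  v2_ge0 : forall a q, closure (QT len1 len2 Tmax) q -> 0 <= v2 a q;
  f_smooth : forall a, smooth_on (closure (QT len1 len2 Tmax) `*` setT)
    (fun z : R * R * R * 'rV[R]_2 => f a z.1 z.2);
  g_smooth : forall a, smooth_on (dQT len1 len2 Tmax) (g a);
  psi_smooth : forall a, smooth_on (closure (omega len1 len2)) (psi a)
}.

Record mesh := Mesh {
  Nx : nat;
  Ny : nat;
  Nt : nat;
  Nx_gt0 : (0 < Nx)%N;
  Ny_gt0 : (0 < Ny)%N;
  Nt_gt0 : (0 < Nt)%N
}.

Definition hx (R : realType) (P : problem R) (N : mesh) : R :=
  len1 P / (Nx N)%:R.
Definition hy (R : realType) (P : problem R) (N : mesh) : R :=
  len2 P / (Ny N)%:R.
Definition tau (R : realType) (P : problem R) (N : mesh) : R :=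
  Tmax P / (Nt N)%:R.

Definition node (R : realType) (P : problem R) (N : mesh) (i j : nat) : R * R :=
  (i%:R * hx P N, j%:R * hy P N).
Definition tnode (R : realType) (P : problem R) (N : mesh) (m : nat) : R :=
  m%:R * tau P N.

(* Mesh points are represented by their indices (i, j). *)
Definition on_mesh (N : mesh) (i j : nat) : bool :=
  (i <= Nx N)%N && (j <= Ny N)%N.
Definition interior_mesh (N : mesh) (i j : nat) : bool :=
  (0 < i < Nx N)%N && (0 < j < Ny N)%N.
Definition boundary_mesh (N : mesh) (i j : nat) : bool :=
  on_mesh N i j && ~~ interior_mesh N i j.

(* U a i j m is U_a((x_i, y_j), t_m); only the values with on_mesh N i j and
   m <= Nt N are meaningful. *)
Definition mesh_fun (R : realType) := 'I_2 -> nat -> nat -> nat -> R.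

Definition vec (R : realType) (U : mesh_fun R) (i j m : nat) : 'rV[R]_2 :=
  \row_b U b i j m.

(* The predecessors i.-1 and j.-1 below are only used at interior nodes, where
   i and j are positive. *)
Definition Dx2 (R : realType) (P : problem R) (N : mesh) (U : mesh_fun R)
    (a : 'I_2) (i j m : nat) : R :=
  (U a i.-1 j m - 2 * U a i j m + U a i.+1 j m) / hx P N ^+ 2.
Definition Dy2 (R : realType) (P : problem R) (N : mesh) (U : mesh_fun R)
    (a : 'I_2) (i j m : nat) : R :=
  (U a i j.-1 m - 2 * U a i j m + U a i j.+1 m) / hy P N ^+ 2.
Definition Dx1 (R : realType) (P : problem R) (N : mesh) (U : mesh_fun R)
    (a : 'I_2) (i j m : nat) : R :=
  (U a i j m - U a i.-1 j m) / hx P N.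
Definition Dy1 (R : realType) (P : problem R) (N : mesh) (U : mesh_fun R)
    (a : 'I_2) (i j m : nat) : R :=
  (U a i j m - U a i j.-1 m) / hy P N.

Definition Lh (R : realType) (P : problem R) (N : mesh) (U : mesh_fun R)
    (a : 'I_2) (i j m : nat) : R :=
  - eps P a * (Dx2 P N U a i j m + Dy2 P N U a i j m)
  + v1 P a (node P N i j, tnode P N m) * Dx1 P N U a i j m
  + v2 P a (node P N i j, tnode P N m) * Dy1 P N U a i j m.

(* Left-hand side of the implicit nonlinear scheme at a time level m >= 1; the
   scheme itself requires it to vanish at the interior nodes. *)
Definition residual (R : realType) (P : problem R) (N : mesh) (U : mesh_fun R)
    (a : 'I_2) (i j m : nat) : R :=
  Lh P N U a i j m + (tau P N)^-1 * U a i j m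
  + f P a (node P N i j, tnode P N m) (vec U i j m)
  - (tau P N)^-1 * U a i j m.-1.

(* Ordered upper (Ut) and lower (Uh) solutions of the scheme, in the
   nondecreasing case. *)
Record ordered_upper_lower (R : realType) (P : problem R) (N : mesh)
    (Ut Uh : mesh_fun R) : Prop := OrderedUpperLower {
  oul_order : forall a i j m, on_mesh N i j -> (1 <= m <= Nt N)%N ->
    Uh a i j m <= Ut a i j m;
  oul_upper : forall a i j m, interior_mesh N i j -> (1 <= m <= Nt N)%N ->
    0 <= residual P N Ut a i j m;
  oul_lower : forall a i j m, interior_mesh N i j -> (1 <= m <= Nt N)%N ->
    residual P N Uh a i j m <= 0;
  oul_boundary : forall a i j m, boundary_mesh N i j -> (1 <= m <= Nt N)%N ->
    Uh a i j m <= g P a (node P N i j, tnode P N m) <= Ut a i j m;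
  oul_initial : forall a i j, on_mesh N i j ->
    Uh a i j 0%N <= psi P a (node P N i j) <= Ut a i j 0%N
}.

Definition lower_candidate (R : realType) (P : problem R) (N : mesh) :
    mesh_fun R :=
  fun a i j m => if m == 0%N then psi P a (node P N i j) else 0.

Record linear_solution (R : realType) (P : problem R) (N : mesh)
    (M : 'I_2 -> R) (U : mesh_fun R) : Prop := LinearSolution {
  ls_interior : forall a i j m, interior_mesh N i j -> (1 <= m <= Nt N)%N ->
    Lh P N U a i j m + (tau P N)^-1 * U a i j m
      = (tau P N)^-1 * U a i j m.-1 + M a;
  ls_boundary : forall a i j m, boundary_mesh N i j -> (1 <= m <= Nt N)%N ->
    U a i j m = g P a (node P N i j, tnode P N m);
  ls_initial : forall a i j, on_mesh N i j ->
    U a i j 0%N = psi P a (node P N i j)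
}.

(* Main.v *)
Require Import Defs.
From mathcomp Require Import zify lra.
Local Open Scope classical_set_scope.
Local Open Scope ring_scope.

(** Everything rests on the discrete minimum principle
    [discrete_minimum_principle] for the implicit operator [Lh + c], [c > 0].
    At an interior node where a mesh function attains its minimum, second
    central differences are nonnegative and backward differences nonpositive;
    as [eps > 0] and [v1, v2 >= 0], this makes [Lh] nonpositive there.  So if
    the minimum were negative, [Lh + c] would be negative at that node.

    Applied level by level in time, with right-hand side
    [tau^-1 * U(t_{m-1}) + M >= 0] and boundary and initial data [g, psi >= 0],
    the principle gives [Ut >= 0] ([linear_solution_ge0]), which is the ordering
    [lower_candidate <= Ut].  The rest is read off from the equations: the
    residual of [Ut] equals [M + f(Ut)], nonnegative since [Ut >= 0] allows the
    bound [f >= - M]; that of the zero function is [f(0) <= 0] minus [tau^-1]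
    times the previous level, which is [psi >= 0] or [0].

    The sign hypotheses are stated on closures and topological boundaries of
    the continuous domains, so it must also be checked that mesh nodes lie in
    them. *)

(** * Mesh nodes in the continuous domain *)

Lemma closure_setX (S T : topologicalType) (A : set S) (B : set T) :
  closure A `*` closure B `<=` closure (A `*` B).
Proof.
move=> [x y] [/= clAx clBy] C [[U V] /= [nbhsU nbhsV] subC].
have [a [Aa Ua]] := clAx _ nbhsU; have [b [Bb Vb]] := clBy _ nbhsV.
by exists (a, b); split=> //; apply: subC.
Qed.

(** The interval is the ball of radius [l / 2] about its midpoint, and closures
    of balls are known. *)
Lemma itvcc_sub_closure (R : realType) (l : R) : 0 < l ->
  `[0, l] `<=` closure `]0, l[%classic.
Proof.
move=> l_gt0; have l2_gt0 : 0 < l / 2 by lra.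
have -> : `]0, l[%classic = ball (l / 2) (l / 2).
  by rewrite ball_itv subrr -splitr.
by rewrite closure_ballE closed_ball_itv// subrr -splitr.
Qed.

Section Coordinates.
Set Implicit Arguments.
Unset Strict Implicit.
Context (R : realType) (l : R) (n : nat).
Hypotheses (l_gt0 : 0 < l) (n_gt0 : (0 < n)%N).
Implicit Type i : nat.

Lemma mesh_coord_le i k : (i%:R * (l / n%:R) <= k%:R * (l / n%:R)) = (i <= k)%N.
Proof. by rewrite ler_pM2r ?ler_nat// divr_gt0 ?ltr0n. Qed.

Lemma mesh_coord_lt i k : (i%:R * (l / n%:R) < k%:R * (l / n%:R)) = (i < k)%N.
Proof. by rewrite ltr_pM2r ?ltr_nat// divr_gt0 ?ltr0n. Qed.

Lemma mesh_coord_end : n%:R * (l / n%:R) = l.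
Proof. by rewrite mulrC divfK// pnatr_eq0 -lt0n. Qed.

Lemma mesh_coord_itvoo i : (i%:R * (l / n%:R) \in `]0, l[) = (0 < i < n)%N.
Proof.
rewrite in_itv/= -{3}mesh_coord_end mesh_coord_lt.
by rewrite pmulr_lgt0 ?ltr0n// divr_gt0 ?ltr0n.
Qed.

Lemma mesh_coord_itvoc i : (i%:R * (l / n%:R) \in `]0, l]) = (0 < i <= n)%N.
Proof.
rewrite in_itv/= -{3}mesh_coord_end mesh_coord_le.
by rewrite pmulr_lgt0 ?ltr0n// divr_gt0 ?ltr0n.
Qed.

Lemma mesh_coord_itvcc i : (i%:R * (l / n%:R) \in `[0, l]) = (i <= n)%N.
Proof.
rewrite in_itv/= -{3}mesh_coord_end mesh_coord_le.
by rewrite pmulr_lge0 ?ler0n// divr_gt0 ?ltr0n.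
Qed.

End Coordinates.

Section Scheme.
Set Implicit Arguments.
Unset Strict Implicit.
Context (R : realType) (P : problem R) (N : mesh).
Implicit Types (U : mesh_fun R) (a : 'I_2) (i j m : nat).

Lemma hx_gt0 : 0 < hx P N.
Proof. by rewrite divr_gt0 ?len1_gt0// ltr0n Nx_gt0. Qed.

Lemma hy_gt0 : 0 < hy P N.
Proof. by rewrite divr_gt0 ?len2_gt0// ltr0n Ny_gt0. Qed.

Lemma tau_gt0 : 0 < tau P N.
Proof. by rewrite divr_gt0 ?Tmax_gt0// ltr0n Nt_gt0. Qed.

Lemma interior_on_mesh i j : interior_mesh N i j -> on_mesh N i j.
Proof. by rewrite /interior_mesh /on_mesh; lia. Qed.

Lemma node_omegaE i j :
  omega (len1 P) (len2 P) (node P N i j) <-> interior_mesh N i j.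
Proof.
rewrite /interior_mesh -(mesh_coord_itvoo (len1_gt0 P) (Nx_gt0 N)).
rewrite -(mesh_coord_itvoo (len2_gt0 P) (Ny_gt0 N)).
by split=> [[? ?]|/andP[? ?]] //; apply/andP.
Qed.

Lemma node_closure_omega i j :
  on_mesh N i j -> closure (omega (len1 P) (len2 P)) (node P N i j).
Proof.
move=> /andP[iN jN]; apply: closure_setX; split.
- apply: (itvcc_sub_closure _ _ (len1_gt0 P)).
  by rewrite /= mesh_coord_itvcc ?len1_gt0 ?Nx_gt0.
- apply: (itvcc_sub_closure _ _ (len2_gt0 P)).
  by rewrite /= mesh_coord_itvcc ?len2_gt0 ?Ny_gt0.
Qed.

Lemma tnode_itv m : (1 <= m <= Nt N)%N -> `]0, Tmax P]%classic (tnode P N m).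
Proof. by rewrite /= mesh_coord_itvoc ?Tmax_gt0 ?Nt_gt0. Qed.

Lemma node_closure_QT i j m : interior_mesh N i j -> (1 <= m <= Nt N)%N ->
  closure (QT (len1 P) (len2 P) (Tmax P)) (node P N i j, tnode P N m).
Proof.
move=> ijN mN; apply: subset_closure; split; last exact: tnode_itv.
exact/node_omegaE.
Qed.

(** The topological boundary is a closure minus an interior; since the interior
    is contained in [omega], a node outside [omega] avoids it. *)
Lemma node_dQT i j m : boundary_mesh N i j -> (1 <= m <= Nt N)%N ->
  dQT (len1 P) (len2 P) (Tmax P) (node P N i j, tnode P N m).
Proof.
move=> /andP[ijN /negP ijNi] mN; split; last exact: tnode_itv.
split; first exact: node_closure_omega.
by move=> /interior_subset/node_omegaE.
Qed.

(** * The discrete minimum principle *)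

(** All four neighbours of an interior node lie on the mesh, so the minimum is
    compared with each of them.  The backward differences are the upwind ones
    for the nonnegative velocities [v1, v2]: their sign at a minimum is known
    whatever the mesh sizes. *)
Lemma Lh_le0_at_min U a i j m :
  interior_mesh N i j -> (1 <= m <= Nt N)%N ->
  (forall k l, on_mesh N k l -> U a i j m <= U a k l m) ->
  Lh P N U a i j m <= 0.
Proof.
move=> ijN mN minU.
have /and4P[xl xr yl yr] :
    [&& on_mesh N i.-1 j, on_mesh N i.+1 j, on_mesh N i j.-1 & on_mesh N i j.+1].
  by move: ijN; rewrite /interior_mesh /on_mesh; lia.
move: (minU _ _ xl) (minU _ _ xr) (minU _ _ yl) (minU _ _ yr) => Uxl Uxr Uyl Uyr.
have Dx2_ge0 : 0 <= Dx2 P N U a i j m.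
  by rewrite divr_ge0 ?sqr_ge0//; lra.
have Dy2_ge0 : 0 <= Dy2 P N U a i j m.
  by rewrite divr_ge0 ?sqr_ge0//; lra.
have Dx1_le0 : Dx1 P N U a i j m <= 0.
  by rewrite pmulr_lle0 ?invr_gt0 ?hx_gt0//; lra.
have Dy1_le0 : Dy1 P N U a i j m <= 0.
  by rewrite pmulr_lle0 ?invr_gt0 ?hy_gt0//; lra.
have qQT := node_closure_QT ijN mN.
have diff_ge0 : 0 <= eps P a * (Dx2 P N U a i j m + Dy2 P N U a i j m).
  by rewrite mulr_ge0 ?addr_ge0// ltW ?eps_gt0.
have v1_le0 := mulr_ge0_le0 (v1_ge0 a qQT) Dx1_le0.
have v2_le0 := mulr_ge0_le0 (v2_ge0 a qQT) Dy1_le0.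
by rewrite /Lh mulNr; lra.
Qed.

Lemma mesh_argmin U a m : exists i j, on_mesh N i j /\
  forall k l, on_mesh N k l -> U a i j m <= U a k l m.
Proof.
pose F (p : 'I_(Nx N).+1 * 'I_(Ny N).+1) := U a p.1 p.2 m.
case: (@arg_minP _ _ _ (ord0, ord0) xpredT F isT) => -[i j] _ minF.
exists i, j; split=> [|k l]; first by rewrite /on_mesh !leq_ord.
rewrite /on_mesh -ltnS -[(l <= _)%N]ltnS => /andP[kN lN].
exact: (minF (Ordinal kN, Ordinal lN)).
Qed.

(** It suffices to bound [U] from below at a node where it attains its minimum.
    At an interior one the hypothesis and [Lh_le0_at_min] leave [0 <= c * U]. *)
Lemma discrete_minimum_principle (c : R) U a m :
  0 < c -> (1 <= m <= Nt N)%N ->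
  (forall i j, boundary_mesh N i j -> 0 <= U a i j m) ->
  (forall i j, interior_mesh N i j -> 0 <= Lh P N U a i j m + c * U a i j m) ->
  forall i j, on_mesh N i j -> 0 <= U a i j m.
Proof.
move=> c_gt0 mN Ubd Uint k l klN.
have [i [j [ijN minU]]] := mesh_argmin U a m.
apply: le_trans (minU _ _ klN).
have [ijNi|ijNb] := boolP (interior_mesh N i j); last first.
  by apply: Ubd; apply/andP.
rewrite -(pmulr_rge0 _ c_gt0); apply: le_trans (Uint _ _ ijNi) _.
by rewrite gerDr; apply: Lh_le0_at_min.
Qed.

(** * The two candidate solutions *)

(** Induction on the time level: nonnegativity at [t_{m-1}] makes the
    right-hand side of the linear problem at [t_m] nonnegative. *)
Lemma linear_solution_ge0 (M : 'I_2 -> R) U :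
  (forall a, 0 <= M a) ->
  (forall a q, dQT (len1 P) (len2 P) (Tmax P) q -> 0 <= g P a q) ->
  (forall a p, closure (omega (len1 P) (len2 P)) p -> 0 <= psi P a p) ->
  linear_solution P N M U ->
  forall a i j m, on_mesh N i j -> (m <= Nt N)%N -> 0 <= U a i j m.
Proof.
move=> M_ge0 g_ge0 psi_ge0 [Uint Ubd Uini] a i j m; elim: m i j => [|m IH] i j.
  by move=> ijN _; rewrite Uini//; apply/psi_ge0/node_closure_omega.
move=> ijN mN.
have tau_inv_gt0 : 0 < (tau P N)^-1 by rewrite invr_gt0 tau_gt0.
apply: (discrete_minimum_principle tau_inv_gt0) ijN => // k l klN.
  by rewrite Ubd//; apply/g_ge0/node_dQT.
rewrite Uint//= addr_ge0// mulr_ge0// ?(ltW tau_inv_gt0)//.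
by apply: IH (ltnW mN); apply: interior_on_mesh.
Qed.

Lemma lower_candidateS a i j m : (0 < m)%N -> lower_candidate P N a i j m = 0.
Proof. by case: m. Qed.

Lemma lower_candidate_ge0 :
  (forall a p, closure (omega (len1 P) (len2 P)) p -> 0 <= psi P a p) ->
  forall a i j m, on_mesh N i j -> 0 <= lower_candidate P N a i j m.
Proof.
move=> psi_ge0 a i j [|m] ijN //.
exact/psi_ge0/node_closure_omega.
Qed.

Lemma residual_lower_candidate a i j m : (0 < m)%N ->
  residual P N (lower_candidate P N) a i j m =
  f P a (node P N i j, tnode P N m) 0
  - (tau P N)^-1 * lower_candidate P N a i j m.-1.
Proof.
move=> m_gt0.
have L0 k l : lower_candidate P N a k l m = 0 by rewrite lower_candidateS.
rewrite /residual /Lh /Dx2 /Dy2 /Dx1 /Dy1 !L0.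
have -> : vec (lower_candidate P N) i j m = 0.
  by apply/rowP => b; rewrite !mxE lower_candidateS.
by rewrite !(mulr0, subr0, addr0, mul0r, add0r, oppr0).
Qed.

(** The linear problem is the scheme with [- M] in place of [f]; its residual
    in the scheme is therefore the gap between [f] and [- M]. *)
Lemma residual_linear_solution (M : 'I_2 -> R) U a i j m :
  linear_solution P N M U -> interior_mesh N i j -> (1 <= m <= Nt N)%N ->
  residual P N U a i j m = M a + f P a (node P N i j, tnode P N m) (vec U i j m).
Proof.
by move=> [Uint _ _] ijN mN; rewrite /residual Uint//; lra.
Qed.

End Scheme.

Theorem theorem7 (R : realType) (P : problem R) (N : mesh) (M : 'I_2 -> R)
  (M_gt0 : forall a, 0 < M a)
  (f0_le0 : forall a q, closure (QT (len1 P) (len2 P) (Tmax P)) q ->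
     f P a q 0 <= 0)
  (f_ge : forall a q (u : 'rV[R]_2),
     closure (QT (len1 P) (len2 P) (Tmax P)) q ->
     (forall b, 0 <= u ord0 b) -> - M a <= f P a q u)
  (g_ge0 : forall a q, dQT (len1 P) (len2 P) (Tmax P) q -> 0 <= g P a q)
  (psi_ge0 : forall a p, closure (omega (len1 P) (len2 P)) p -> 0 <= psi P a p)
  (Ut : mesh_fun R) (Ut_sol : linear_solution P N M Ut) :
  ordered_upper_lower P N Ut (lower_candidate P N) /\
  (forall a i j m, on_mesh N i j -> (1 <= m <= Nt N)%N ->
     0 <= lower_candidate P N a i j m <= Ut a i j m).
Proof.
have Ut_ge0 : forall a i j m, on_mesh N i j -> (m <= Nt N)%N -> 0 <= Ut a i j m.
  by apply: linear_solution_ge0 Ut_sol => // a; apply: ltW.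
split; last first.
  move=> a i j m ijN /andP[m_gt0 mN].
  by rewrite lower_candidateS// lexx Ut_ge0.
split=> [a i j m ijN|a i j m ijN mN|a i j m ijN mN|a i j m ijN mN|a i j ijN].
- by move=> /andP[m_gt0 mN]; rewrite lower_candidateS// Ut_ge0.
- rewrite (residual_linear_solution a Ut_sol)// addrC -lerBlDr sub0r.
  apply: f_ge => [|b]; first exact: node_closure_QT.
  by rewrite mxE Ut_ge0 ?interior_on_mesh//; case/andP: mN.
- have m_gt0 : (0 < m)%N by case/andP: mN.
  rewrite residual_lower_candidate// subr_le0; apply: (@le_trans _ _ 0).
    by apply: f0_le0; apply: node_closure_QT.
  rewrite mulr_ge0 ?invr_ge0 ?(ltW (tau_gt0 _ _))//.
  by apply: lower_candidate_ge0 => //; apply: interior_on_mesh.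
- rewrite (ls_boundary Ut_sol)// lexx andbT lower_candidateS; last by case/andP: mN.
  by apply: g_ge0; apply: node_dQT.
- by rewrite (ls_initial Ut_sol)// lexx.
Qed.
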